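(* Let $m$ be a positive integer and let $(a_k)_{k\in\mathbb{Z}}$ be complex numbers with $\sum_{k=-\infty}^{\infty}|k a_k|<\infty$. Define $g(z)=\sum_{k=-\infty}^{\infty}a_k\,\bar z^{k}z^{2m-k}$ for $z\ne0$ and $g(0)=0$. Suppose at least one of the following conditions holds (they are increasingly weaker): (i) there exists an integer $l\le m$ with $|a_l|>\sum_{n\ne l}|a_n|$; (ii) there exists an integer $l\le m$ with $a_l\neq0$ and $\sum_{n=1}^{\infty}\bigl|\frac{a_{l+n}}{a_l}+\frac{\overline{a_{l-n}}}{\overline{a_l}}\bigr|<1$; (iii) there exists an integer $l\le m$ with $a_l\ne0$ and $\operatorname{Re}\Bigl(1+\sum_{n=1}^{\infty}\bigl(\frac{a_{l+n}}{a_l}+\frac{\overline{a_{l-n}}}{\overline{a_l}}\bigr)w^n\Bigr)>0$ for all $|w|=1$. Then $g$ is an even, homogeneous (of degree $2m$) $C^1$ function that satisfies the polynomial condition.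
   Context: Homogeneous of degree $d$ means $g(tz)=t^dg(z)$ for all $t>0$. Polynomial condition: let $g$ be an even $C^1$ function defined near $0\in\mathbb{C}$ with $g(z)=o(z)$ as $z\to0$. We say $g$ satisfies the polynomial condition (with respect to a holomorphic polynomial $p(\zeta_1,\zeta_2)$) if for every $C^1$ function $R$ defined near $0$ with $R(z)=o(g(z))$ as $z\to0$, both $\operatorname{Im} p(z,\bar z+g(z)+R(z))>0$ and $\operatorname{Im} p(z,\bar z-g(z)+R(z))<0$ hold for all $z\neq0$ sufficiently close to $0$; ''$g$ satisfies the polynomial condition'' means this holds for some polynomial $p$. *)

(* Defs.v *)
(* MathComp + MathComp-Analysis; complex numbers are mathcomp-real-closed's R[i]
   over an arbitrary R : realType. *)
From HB Require Import structures.
From mathcomp Require Import all_boot all_order all_algebra.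
From mathcomp Require Import all_classical all_reals all_analysis.
From mathcomp Require Import complex.
Set Implicit Arguments. Unset Strict Implicit. Unset Printing Implicit Defensive.
Import Order.TTheory GRing.Theory Num.Theory.
Import numFieldNormedType.Exports.
Local Open Scope classical_set_scope.
Local Open Scope ring_scope.
Local Open Scope complex_scope.

Section Defs.
Variable R : realType.

(* identification C = R^2 used for real differentiability *)
Definition toC (p : R * R) : R[i] := Complex p.1 p.2.
Definition ofC (z : R[i]) : R * R := (complex.Re z, complex.Im z).

(* f : C -> C is C^1 (as a map R^2 -> R^2) on the open set U of C:
   differentiable at every point of U, with continuous derivative (checked on
   every direction v, which in finite dimension is continuity of x |-> Df(x)). *)
Definition C1_on (U : set R[i]) (f : R[i] -> R[i]) : Prop :=
  let F := ofC \o f \o toC in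
  (forall p : R * R, U (toC p) -> differentiable F p) /\
  (forall v : R * R, forall p : R * R, U (toC p) ->
      {for p, continuous (fun q => 'd F q v)}).

(* modulus of a complex number, as a real number *)
Definition cmod (z : R[i]) : R := Num.sqrt (complex.Re z ^+ 2 + complex.Im z ^+ 2).

Definition disk (d : R) : set R[i] := [set z | cmod z < d].

(* f is C^1 near 0 *)
Definition C1_near0 (f : R[i] -> R[i]) : Prop :=
  exists d : R, 0 < d /\ C1_on (disk d) f.

(* f(z) = o(h(z)) as z -> 0 *)
Definition little_o0 (f h : R[i] -> R[i]) : Prop :=
  forall eps : R, 0 < eps -> exists d : R, 0 < d /\
    forall z, cmod z < d -> cmod (f z) <= eps * cmod (h z).

(* holomorphic polynomials in two variables: {poly {poly C}}, outer variable = zeta2 *)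
Definition peval2 (p : {poly {poly R[i]}}) (z1 z2 : R[i]) : R[i] :=
  (p.[z2%:P]).[z1].

(* the polynomial condition (for g even, C^1 near 0, g(z) = o(z)) *)
Definition poly_condition (g : R[i] -> R[i]) : Prop :=
  (exists d : R, 0 < d /\ forall z, cmod z < d -> g (- z) = g z) /\
  C1_near0 g /\ little_o0 g id /\
  exists p : {poly {poly R[i]}},
    forall Rf : R[i] -> R[i], C1_near0 Rf -> little_o0 Rf g ->
      exists d : R, 0 < d /\ forall z, z != 0 -> cmod z < d ->
        0 < complex.Im (peval2 p z (z^* + g z + Rf z)) /\
        complex.Im (peval2 p z (z^* - g z + Rf z)) < 0.

(* sum of a (convergent) series of reals / complex numbers *)
Definition rseries (u : nat -> R) : R := limn (series u).
(* complex series: limit taken componentwise (convergence in C = in R^2) *)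
Definition cseries (u : nat -> R[i]) : R[i] :=
  Complex (rseries (fun n => complex.Re (u n))) (rseries (fun n => complex.Im (u n))).

(* sums over Z *)
Definition zsumR (u : int -> R) : R :=
  rseries (fun n => u n%:Z) + rseries (fun n => u (- (n.+1)%:Z)).
Definition zsumC (u : int -> R[i]) : R[i] :=
  cseries (fun n => u n%:Z) + cseries (fun n => u (- (n.+1)%:Z)).

(* sum_{k in Z} u_k < oo, for u >= 0 *)
Definition zsummable (u : int -> R) : Prop :=
  (\sum_(n <oo) (u n%:Z)%:E < +oo)%E /\ (\sum_(n <oo) (u (- (n.+1)%:Z))%:E < +oo)%E.

(* g(z) = sum_k a_k conj(z)^k z^(2m-k) for z <> 0, g(0) = 0 *)
Definition gfun (m : nat) (a : int -> R[i]) (z : R[i]) : R[i] :=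
  if z == 0 then 0
  else zsumC (fun k => a k * (z^*) ^ k * z ^ ((2 * m)%:Z - k)).

Definition bcoef (a : int -> R[i]) (l : int) (n : nat) : R[i] :=
  a (l + n%:Z) / a l + (a (l - n%:Z))^* / (a l)^*.

End Defs.

(* Main.v *)
(* Writing u = conj z / z, one has g(z) = z^(2m) H(u) with H(u) = sum_k a_k u^k
   on the unit circle, a sum of a power series in u and one in conj u with
   summable derivatives.  The difference quotients of these power series extend
   continuously to the diagonal of the closed disk (Tannery), which gives
   g(w) - g(z) = A(w,z) (w - z) + B(w,z) conj (w - z) with A and B continuous on
   the diagonal, hence g is C^1.

   Conditions (i) and (ii) imply (iii), which says that
   Re (conj z ^ N g(z) / a_l) > 0 on the unit circle, where N = 2 (m - l) >= 0;
   by compactness and homogeneity this quantity is at least c |z|^(N + 2m).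
   Take p(z1, z2) = b z2^(N+1) + conj b z1^(N+1) with b = i / a_l.  It is real on
   z2 = conj z1, and for h = +-g + o(g) one has
   Im p(z, conj z + h) = (N + 1) Re (conj z ^ N h / a_l) + o(|z|^(N + 2m)),
   whose sign is that of +-. *)
Require Import Defs.
From HB Require Import structures.
From mathcomp Require Import all_boot all_order all_algebra.
From mathcomp Require Import all_classical all_reals all_analysis.
From mathcomp Require Import complex.
From mathcomp Require Import ring lra zify.
Import Order.TTheory GRing.Theory Num.Theory.
Import numFieldNormedType.Exports.
Local Open Scope classical_set_scope.
Local Open Scope ring_scope.
Local Open Scope complex_scope.
(* With [ring_scope] on top, [z^*] is [Num.conj z], as in the body of [gfun]. *)
Local Open Scope ring_scope.
Set Implicit Arguments. Unset Strict Implicit. Unset Printing Implicit Defensive.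

(** Gives [R[i]] the norm and topology of the regular module over itself, so that limit lemmas for
    normed modules apply to complex-valued maps. *)
HB.instance Definition _ (R : realType) := NormedModule.copy R[i] R[i]^o.

(** * Modulus, real and imaginary parts, and limits in C = R^2 *)

Section Complex.
Variable R : realType.
Implicit Types z w : R[i].

Lemma normc_cmod z : `|z| = (cmod z)%:C.
Proof. by rewrite normc_def. Qed.

Lemma cmod_ge0 z : 0 <= cmod z.
Proof. exact: sqrtr_ge0. Qed.

Lemma cmodM z w : cmod (z * w) = cmod z * cmod w.
Proof. by apply: complexI; rewrite rmorphM /= -!normc_cmod normrM. Qed.

Lemma cmodD z w : cmod (z + w) <= cmod z + cmod w.
Proof. by rewrite -lecR rmorphD /= -!normc_cmod ler_normD. Qed.

Lemma cmodN z : cmod (- z) = cmod z.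
Proof. by apply: complexI; rewrite -!normc_cmod normrN. Qed.

Lemma cmodBC z w : cmod (z - w) = cmod (w - z).
Proof. by rewrite -cmodN opprB. Qed.

Lemma conjCE z : z^* = conjc z. Proof. by []. Qed.

Lemma cmodJ z : cmod z^* = cmod z.
Proof. by rewrite conjCE; case: z => x y; rewrite /cmod /= sqrrN. Qed.

Lemma cmod0 : cmod (0 : R[i]) = 0.
Proof. by apply: complexI; rewrite -normc_cmod normr0. Qed.

Lemma cmod1 : cmod (1 : R[i]) = 1.
Proof. by apply: complexI; rewrite -normc_cmod normr1. Qed.

Lemma cmod_eq0 z : (cmod z == 0) = (z == 0).
Proof. by rewrite -(inj_eq (@complexI R)) -normc_cmod normr_eq0. Qed.

Lemma cmod_gt0 z : (0 < cmod z) = (z != 0).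
Proof. by rewrite lt_neqAle cmod_ge0 andbT eq_sym cmod_eq0. Qed.

Lemma cmodV z : cmod z^-1 = (cmod z)^-1.
Proof. by apply: complexI; rewrite fmorphV /= -!normc_cmod normfV. Qed.

Lemma cmodX z n : cmod (z ^+ n) = cmod z ^+ n.
Proof. by apply: complexI; rewrite rmorphXn /= -!normc_cmod normrX. Qed.

Lemma cmodR (x : R) : cmod x%:C = `|x|.
Proof. by rewrite /cmod /= expr0n addr0 sqrtr_sqr. Qed.

Lemma cmod_nat n : cmod (n%:R : R[i]) = n%:R.
Proof. by rewrite -(rmorph_nat (real_complex R)) cmodR normr_nat. Qed.

Lemma cmod_sum (I : Type) (r : seq I) (P : pred I) (f : I -> R[i]) :
  cmod (\sum_(i <- r | P i) f i) <= \sum_(i <- r | P i) cmod (f i).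
Proof.
elim/big_rec2: _ => [|i x y _ h]; first by rewrite cmod0.
by rewrite (le_trans (cmodD _ _))// lerD2l.
Qed.

Lemma Re_le_cmod z : `|complex.Re z| <= cmod z.
Proof. by rewrite /cmod -sqrtr_sqr ler_wsqrtr// lerDl sqr_ge0. Qed.

Lemma Im_le_cmod z : `|complex.Im z| <= cmod z.
Proof. by rewrite /cmod -sqrtr_sqr ler_wsqrtr// lerDr sqr_ge0. Qed.

Lemma cmod_le_ReIm z : cmod z <= `|complex.Re z| + `|complex.Im z|.
Proof.
rewrite {1}(complexE z) (le_trans (cmodD _ _))// cmodM !cmodR.
by rewrite /cmod /= expr0n expr1n add0r sqrtr1 mul1r.
Qed.

Lemma ReD z w : complex.Re (z + w) = complex.Re z + complex.Re w.
Proof. by case: z; case: w. Qed.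

Lemma ImD z w : complex.Im (z + w) = complex.Im z + complex.Im w.
Proof. by case: z; case: w. Qed.

Lemma ReN z : complex.Re (- z) = - complex.Re z.
Proof. by case: z. Qed.

Lemma ImN z : complex.Im (- z) = - complex.Im z.
Proof. by case: z. Qed.

Lemma ReJ z : complex.Re z^* = complex.Re z.
Proof. by rewrite conjCE; case: z. Qed.

Lemma ReZ (x : R) z : complex.Re (x%:C * z) = x * complex.Re z.
Proof. by case: z => u v /=; rewrite mul0r subr0. Qed.

Lemma Re_sum (I : Type) (r : seq I) (P : pred I) (f : I -> R[i]) :
  complex.Re (\sum_(i <- r | P i) f i) = \sum_(i <- r | P i) complex.Re (f i).
Proof. by apply: (big_morph _ ReD). Qed.

Lemma Im_sum (I : Type) (r : seq I) (P : pred I) (f : I -> R[i]) :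
  complex.Im (\sum_(i <- r | P i) f i) = \sum_(i <- r | P i) complex.Im (f i).
Proof. by apply: (big_morph _ ImD). Qed.

(** The norm of [R[i]] takes values in [R[i]], so limits there quantify over positive complex
    numbers; such a number is real, hence testing real [e] suffices. *)
Lemma cvg_cmodP (T : Type) (F : set_system T) {FF : Filter F}
    (f : T -> R[i]) (l : R[i]) :
  f @ F --> l <-> forall e : R, 0 < e -> \forall t \near F, cmod (f t - l) < e.
Proof.
split=> [fl e e0|H].
  have e0' : 0 < e%:C by rewrite ltcR.
  move/cvgrPdist_lt/(_ _ e0') : fl; apply: filterS => t.
  by rewrite normc_cmod ltcR cmodBC.
apply/cvgrPdist_lt => e e0.
have eE : e = (complex.Re e)%:C by rewrite RRe_real// gtr0_real.
have e0' : 0 < complex.Re e by rewrite -ltcR -eE.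
by apply: filterS (H _ e0') => t; rewrite eE normc_cmod ltcR cmodBC.
Qed.

Lemma cvg_Re (T : Type) (F : set_system T) {FF : Filter F}
    (f : T -> R[i]) (l : R[i]) :
  f @ F --> l -> (fun t => complex.Re (f t)) @ F --> complex.Re l.
Proof.
move=> /cvg_cmodP H; apply/cvgrPdist_lt => e /H; apply: filterS => t.
by apply: le_lt_trans; rewrite distrC -ReN -ReD Re_le_cmod.
Qed.

Lemma cvg_Im (T : Type) (F : set_system T) {FF : Filter F}
    (f : T -> R[i]) (l : R[i]) :
  f @ F --> l -> (fun t => complex.Im (f t)) @ F --> complex.Im l.
Proof.
move=> /cvg_cmodP H; apply/cvgrPdist_lt => e /H; apply: filterS => t.
by apply: le_lt_trans; rewrite distrC -ImN -ImD Im_le_cmod.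
Qed.

Lemma cvg_ReIm (T : Type) (F : set_system T) {FF : Filter F}
    (f : T -> R[i]) (l : R[i]) :
  (fun t => complex.Re (f t)) @ F --> complex.Re l ->
  (fun t => complex.Im (f t)) @ F --> complex.Im l -> f @ F --> l.
Proof.
move=> /cvgrPdist_lt Hr /cvgrPdist_lt Hi; apply/cvg_cmodP => e e0.
have e2 : 0 < e / 2 by rewrite divr_gt0.
apply: filterS2 (Hr _ e2) (Hi _ e2) => t /= hr hi.
rewrite (le_lt_trans (cmod_le_ReIm _))// ReD ImD ReN ImN.
by rewrite [ltRHS]splitr ltrD// distrC.
Qed.

Lemma cvg_conjc (T : Type) (F : set_system T) {FF : Filter F}
    (f : T -> R[i]) (l : R[i]) :
  f @ F --> l -> (fun t => (f t)^*) @ F --> l^*.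
Proof.
move=> /cvg_cmodP H; apply/cvg_cmodP => e /H; apply: filterS => t.
by rewrite -rmorphB cmodJ.
Qed.

Lemma cvg_cmod_le0 (T : Type) (F : set_system T) {FF : Filter F}
    (f g : T -> R[i]) :
  (forall t, cmod (f t) <= cmod (g t)) -> g @ F --> (0 : R[i]) ->
  f @ F --> (0 : R[i]).
Proof.
move=> fg /cvg_cmodP H; apply/cvg_cmodP => e /H; apply: filterS => t.
by rewrite !subr0; apply: le_lt_trans.
Qed.

Lemma cvg_toC (T : Type) (F : set_system T) {FF : Filter F}
    (f : T -> R * R) (p : R * R) :
  f @ F --> p -> (fun t => toC (f t)) @ F --> toC p.
Proof.
have h : toC q @[q --> p] --> toC p.
  by apply: cvg_ReIm; case: p => a b; [exact: cvg_fst|exact: cvg_snd].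
by move=> fp; exact: (cvg_comp _ _ fp h).
Qed.

Lemma cvg_ofC (T : Type) (F : set_system T) {FF : Filter F}
    (f : T -> R[i]) (l : R[i]) :
  f @ F --> l -> (fun t => ofC (f t)) @ F --> ofC l.
Proof. 
move=> fl; exact: (@cvg_pair _ _ _ F _ _ _ _ _ _ _ (cvg_Re fl) (cvg_Im fl)).
 Qed.

Lemma toCD (p q : R * R) : toC (p + q) = toC p + toC q.
Proof. by case: p; case: q. Qed.

Lemma ofCK z : toC (ofC z) = z.
Proof. by case: z. Qed.

Lemma ofCD z w : ofC (z + w) = ofC z + ofC w.
Proof. by rewrite /ofC ReD ImD. Qed.

Lemma ofC_norm z : `|ofC z| <= cmod z.
Proof. by rewrite prod_normE /= ge_max Re_le_cmod Im_le_cmod. Qed.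

(** [R * R] carries the maximum norm, while the modulus is bounded by the sum of the two
    coordinates; hence the factor 2. *)
Lemma toC_norm (p : R * R) : cmod (toC p) <= 2 * `|p|.
Proof.
rewrite (le_trans (cmod_le_ReIm _))//= mulr_natl mulr2n prod_normE /=.
by rewrite lerD// le_max lexx ?orbT.
Qed.

End Complex.

(** * Absolutely convergent real and complex series *)

Section ComplexSeries.
Variable R : realType.
Implicit Types (u v : nat -> R[i]) (r s : nat -> R).

Lemma rseries_cvg_le r s : (forall n, `|r n| <= s n) ->
  cvgn (series s) -> cvgn (series r).
Proof.
move=> rs cs; apply: normed_cvg; apply: (series_le_cvg _ _ rs cs) => n //.
exact: le_trans (normr_ge0 _) (rs n).
Qed.

(** Beyond [N] the partial sums of [r] move by at most those of [s], which stay below their limit; a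
    partial sum of index at least [N] and close to [rseries r] carries the bound over to the
    limit. *)
Lemma rseries_tail r s N : (forall n, `|r n| <= s n) -> cvgn (series s) ->
  `|rseries r - series r N| <= rseries s - series s N.
Proof.
move=> rs cs; have cr := rseries_cvg_le rs cs.
have s0 n : 0 <= s n by apply: le_trans (rs n).
apply/ler_addgt0Pr => e e0.
move/cvgrPdist_lt/(_ _ e0) : (cr) => [M _ HM].
pose n := maxn M N.
have := HM n (leq_maxl _ _).
have sle : series s n <= rseries s.
  by apply: nondecreasing_cvgn_le => //; apply: nondecreasing_series.
have : `|series r n - series r N| <= series s n - series s N.
  rewrite !sub_series leq_maxr (le_trans (ler_norm_sum _ _ _))//.
  exact: ler_sum.
rewrite -/(rseries r) => h1 h2.
have h3 := ler_distD (series r n) (rseries r) (series r N).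
lra.
Qed.

Lemma rseries_ge0 r : (forall n, 0 <= r n) -> cvgn (series r) -> 0 <= rseries r.
Proof.
(* The tail bound at [N = 0], with the zero series dominated by [r], puts [rseries r] above a
   norm. *)
move=> r0 cr; have := @rseries_tail (fun=> 0) r 0.
rewrite /series /= !big_geq// !subr0 => h.
by apply: le_trans (h _ cr) => // n; rewrite normr0.
Qed.

Lemma rseries_norm_le r s : (forall n, `|r n| <= s n) -> cvgn (series s) ->
  `|rseries r| <= rseries s.
Proof.
move=> rs cs; have := @rseries_tail r s 0 rs cs.
by rewrite /series /= !big_geq// !subr0.
Qed.

Lemma rseries_le r s : (forall n, 0 <= r n <= s n) -> cvgn (series s) ->
  rseries r <= rseries s.
Proof.
move=> rs cs; apply: le_trans (ler_norm _) (rseries_norm_le _ cs) => n.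
by have /andP[? ?] := rs n; rewrite ger0_norm.
Qed.

Lemma rseriesD r s : cvgn (series r) -> cvgn (series s) ->
  rseries (fun n => r n + s n) = rseries r + rseries s.
Proof.
move=> cr cs; rewrite /rseries -limD//; congr (limn _).
by apply/funext => n; rewrite /series /= big_split.
Qed.

Lemma cvg_seriesD r s : cvgn (series r) -> cvgn (series s) ->
  cvgn (series (fun n => r n + s n)).
Proof. by move=> cr cs; apply: is_cvg_seriesD. Qed.

Lemma rseriesZ (x : R) r : cvgn (series r) ->
  rseries (fun n => x * r n) = x * rseries r.
Proof.
move=> cr; apply/cvg_lim => //.
have -> : series (fun n => x * r n) = (fun n => x * series r n).
  by apply/funext => n; rewrite /series /= mulr_sumr.
exact: cvgMr.
Qed.

Lemma cvg_seriesZ (x : R) r : cvgn (series r) -> cvgn (series (fun n => x * r n)).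
Proof. by move=> cr; apply: is_cvg_seriesZ. Qed.

Lemma rseries_recl r : cvgn (series r) ->
  cvgn (series (fun n => r n.+1)) /\ rseries r = r 0%N + rseries (fun n => r n.+1).
Proof.
move=> cr.
have E : series (fun n => r n.+1) = (fun n => series r n.+1 - r 0%N).
  by apply/funext => n; rewrite /series /= [in RHS]big_nat_recl// addrC addKr.
have H : series (fun n => r n.+1) @ \oo --> rseries r - r 0%N.
  rewrite E; apply: cvgB; last exact: cvg_cst.
  by rewrite (@cvg_shiftS _ (series r)).
split; first by apply/cvg_ex; exists (rseries r - r 0%N).
by rewrite /rseries (cvg_lim _ H)// addrC subrK.
Qed.

Lemma cvg_series_recl r : cvgn (series (fun n => r n.+1)) -> cvgn (series r).
Proof.
move=> cr; apply/cvg_ex; exists (r 0%N + rseries (fun n => r n.+1)).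
rewrite -(@cvg_shiftS _ (series r)).
have -> : (fun n => series r n.+1) = (fun n => r 0%N + series (fun n => r n.+1) n).
  by apply/funext => n; rewrite /series /= big_nat_recl.
by apply: cvgD => //; exact: cvg_cst.
Qed.

Definition abs_cvg u := cvgn (series (fun n => cmod (u n))).

Lemma abs_cvg_Re u : abs_cvg u -> cvgn (series (fun n => complex.Re (u n))).
Proof. by apply: rseries_cvg_le => n; exact: Re_le_cmod. Qed.

Lemma abs_cvg_Im u : abs_cvg u -> cvgn (series (fun n => complex.Im (u n))).
Proof. by apply: rseries_cvg_le => n; exact: Im_le_cmod. Qed.

Lemma cseries_cvg u : abs_cvg u -> series u @ \oo --> cseries u.
Proof.
move=> cu; apply: cvg_ReIm.
- under eq_fun do rewrite Re_sum; exact: abs_cvg_Re.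
- under eq_fun do rewrite Im_sum; exact: abs_cvg_Im.
Qed.

(** [cseries] is a pair of componentwise limits; identifying it with a limit in C lets identities
    between series be proved on complex partial sums. *)
Lemma cseriesE u l : series u @ \oo --> l -> cseries u = l.
Proof.
move=> H.
have h1 : series (fun n => complex.Re (u n)) @ \oo --> complex.Re l.
  by rewrite /series /=; under eq_fun do rewrite -Re_sum; exact: cvg_Re H.
have h2 : series (fun n => complex.Im (u n)) @ \oo --> complex.Im l.
  by rewrite /series /=; under eq_fun do rewrite -Im_sum; exact: cvg_Im H.
rewrite /cseries /rseries (cvg_lim _ h1)// (cvg_lim _ h2)//.
by case: l {H h1 h2}.
Qed.

Lemma cseries_tail u s N : (forall n, cmod (u n) <= s n) -> cvgn (series s) ->
  cmod (cseries u - series u N) <= rseries s - series s N.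
Proof.
move=> us cs.
have s0 n : 0 <= s n by apply: le_trans (us n); exact: cmod_ge0.
have cu : abs_cvg u.
  by apply: rseries_cvg_le cs => n; rewrite ger0_norm ?cmod_ge0.
apply/ler_addgt0Pr => e e0.
move/cvg_cmodP/(_ _ e0) : (cseries_cvg cu) => [M _ HM].
pose n := maxn M N.
have := HM n (leq_maxl _ _); rewrite cmodBC.
have sle : series s n <= rseries s.
  by apply: nondecreasing_cvgn_le => //; apply: nondecreasing_series.
have : cmod (series u n - series u N) <= series s n - series s N.
  rewrite !sub_series leq_maxr (le_trans (cmod_sum _ _ _))//.
  exact: ler_sum.
move=> h1 h2.
have h3 := cmodD (cseries u - series u n) (series u n - series u N).
rewrite addrA subrK in h3; lra.
Qed.

Lemma cseries_le u s : (forall n, cmod (u n) <= s n) -> cvgn (series s) ->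
  cmod (cseries u) <= rseries s.
Proof.
move=> us cs; have := @cseries_tail u s 0 us cs.
by rewrite /series /= !big_geq// !subr0.
Qed.

Lemma cseriesD u v : abs_cvg u -> abs_cvg v ->
  cseries (fun n => u n + v n) = cseries u + cseries v.
Proof.
move=> cu cv; apply: cseriesE.
have -> : series (fun n => u n + v n) = (fun n => series u n + series v n).
  by apply/funext => n; rewrite /series /= big_split.
by apply: cvgD; exact: cseries_cvg.
Qed.

Lemma cseriesZ z u : abs_cvg u -> cseries (fun n => z * u n) = z * cseries u.
Proof.
move=> cu; apply: cseriesE.
have -> : series (fun n => z * u n) = (fun n => z * series u n).
  by apply/funext => n; rewrite /series /= mulr_sumr.
by apply: cvgMr; exact: cseries_cvg.
Qed.

Lemma abs_cvgZ z u : abs_cvg u -> abs_cvg (fun n => z * u n).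
Proof.
by rewrite /abs_cvg; under [in X in _ -> X]eq_fun do rewrite cmodM;
  exact: cvg_seriesZ.
Qed.

(* Tannery's theorem *)
Lemma cvg_cseries (T : Type) (F : set_system T) {FF : Filter F}
    (u : nat -> T -> R[i]) (u0 : nat -> R[i]) s :
  cvgn (series s) -> (forall n t, cmod (u n t) <= s n) ->
  (forall n, cmod (u0 n) <= s n) -> (forall n, u n t @[t --> F] --> u0 n) ->
  cseries (u ^~ t) @[t --> F] --> cseries u0.
Proof.
move=> cs us u0s uu0; apply/cvg_cmodP => e e0.
have e3 : 0 < e / 3 by rewrite divr_gt0.
(* At this [N] the tail of [s] bounds the tails of both series uniformly in [t]; what remains is a
   finite sum, whose limit is taken term by term. *)
move/cvgrPdist_lt/(_ _ e3) : (cs) => [N _ /(_ N (leqnn _))].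
rewrite -/(rseries s) => HN.
have cN : series (u ^~ t) N @[t --> F] --> series u0 N.
  rewrite /series /=; elim: (index_iota 0 N) => [|i r IH].
    by under eq_fun do rewrite big_nil; rewrite big_nil; exact: cvg_cst.
  under eq_fun do rewrite big_cons; rewrite big_cons; exact: (cvgD (uu0 i) IH).
move/cvg_cmodP/(_ _ e3): cN; apply: filterS => t Ht.
have h1 := cseries_tail N (fun n => us n t) cs.
have h2 := cseries_tail N u0s cs.
have h3 := ler_norm (rseries s - series s N).
have -> : cseries (u ^~ t) - cseries u0 =
  (cseries (u ^~ t) - series (u ^~ t) N) + ((series (u ^~ t) N - series u0 N)
   - (cseries u0 - series u0 N)) by ring.
rewrite (le_lt_trans (cmodD _ _))//.
have := cmodD (series (u ^~ t) N - series u0 N) (- (cseries u0 - series u0 N)).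
rewrite cmodN; lra.
Qed.

End ComplexSeries.

(** * Two-sided series over the integers *)

Section IntSeries.
Variable R : realType.
Implicit Types (v : int -> R) (r : nat -> R).

Definition zcvg v :=
  cvgn (series (fun n => v n%:Z)) /\ cvgn (series (fun n => v (- (n.+1)%:Z))).

(** The term [v 0] passes from the nonnegative half to the negative half; the total is unchanged. *)
Lemma zsumR_shift1 v : zcvg v ->
  zcvg (fun k => v (k + 1)) /\ zsumR (fun k => v (k + 1)) = zsumR v.
Proof.
move=> [cp cn]; rewrite /zcvg /zsumR.
have -> : (fun n : nat => v (n%:Z + 1)) = (fun n => v n.+1%:Z).
  by apply/funext => n; congr v; lia.
have -> : (fun n : nat => v (- n.+1%:Z + 1)) = (fun n => v (- n%:Z)).
  by apply/funext => n; congr v; lia.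
have [cp' ->] := rseries_recl cp.
have cn' : cvgn (series (fun n : nat => v (- n%:Z))) by exact: cvg_series_recl.
have [_ ->] := rseries_recl cn'.
by split=> //; rewrite oppr0; ring.
Qed.

Lemma zsumR_shiftN1 v : zcvg v ->
  zcvg (fun k => v (k - 1)) /\ zsumR (fun k => v (k - 1)) = zsumR v.
Proof.
move=> [cp cn]; rewrite /zcvg /zsumR.
have cp' : cvgn (series (fun n : nat => v (n%:Z - 1))).
  apply: cvg_series_recl; rewrite (_ : (fun n => _) = (fun n : nat => v n%:Z))//.
  by apply/funext => n; congr v; lia.
have -> : (fun n : nat => v (- n.+1%:Z - 1)) = (fun n => v (- n.+2%:Z)).
  by apply/funext => n; congr v; lia.
have [_ ->] := rseries_recl cp'.
have -> : (fun n : nat => v (n.+1%:Z - 1)) = (fun n => v n%:Z).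
  by apply/funext => n; congr v; lia.
have [cn' ->] := rseries_recl cn.
by split=> //; rewrite (_ : (0%:Z - 1) = - 1%:Z)//; ring.
Qed.

Lemma zsumR_shift v (l : int) : zcvg v ->
  zcvg (fun k => v (k + l)) /\ zsumR (fun k => v (k + l)) = zsumR v.
Proof.
move=> cv; elim: l => [|n|n].
- by rewrite (_ : (fun k => v (k + 0)) = v)//; apply/funext => k; rewrite addr0.
- case=> /zsumR_shift1[c e] <-.
  rewrite (_ : (fun k => v (k + n.+1%:Z)) = (fun k => v (k + 1 + n%:Z)))//.
  by apply/funext => k; congr v; lia.
- case=> /zsumR_shiftN1[c e] <-.
  rewrite (_ : (fun k => v (k + - n.+1%:Z)) = (fun k => v (k - 1 + - n%:Z)))//.
  by apply/funext => k; congr v; lia.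
Qed.

Lemma zsumR_fold v : zcvg v ->
  zsumR v = v 0 + rseries (fun n => v n.+1%:Z + v (- n.+1%:Z)).
Proof.
move=> [cp cn]; have [cp' e] := rseries_recl cp.
by rewrite /zsumR e rseriesD// addrA.
Qed.

Lemma zsumC_Re (u : int -> R[i]) :
  complex.Re (zsumC u) = zsumR (fun k => complex.Re (u k)).
Proof. by rewrite /zsumC ReD. Qed.

Lemma nneseries_cvg_series r : (forall n, 0 <= r n) ->
  (\sum_(n <oo) (r n)%:E < +oo)%E -> cvgn (series r).
Proof.
move=> r0 roo; set L := (\sum_(n <oo) (r n)%:E)%E in roo.
have L0 : (0 <= L)%E by apply: nneseries_ge0 => n _ _; rewrite lee_fin.
apply: nondecreasing_is_cvgn; first exact: nondecreasing_series.
exists (fine L) => _ [n _ <-].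
rewrite -lee_fin fineK ?ge0_fin_numE// /series /= -sumEFin.
by apply: nneseries_lim_ge => k _ _; rewrite lee_fin.
Qed.

End IntSeries.

(** * Power series on the closed unit disk and their difference quotients *)

Section PowerSeries.
Variable R : realType.
Implicit Types (c : nat -> R[i]) (e : nat -> nat) (u v w z : R[i]).

(** The quotient (v^n - u^n) / (v - u) written as a polynomial, so that it also makes sense for v =
    u, where it is n u^(n-1). At n = 0 the sum is empty. *)
Definition divdiff n v u : R[i] := \sum_(i < n) v ^+ (n.-1 - i) * u ^+ i.

Lemma cmod_divdiff n v u : cmod v <= 1 -> cmod u <= 1 -> cmod (divdiff n v u) <= n%:R.
Proof.
move=> v1 u1; rewrite (le_trans (cmod_sum _ _ _))//.
rewrite -[X in _ <= X%:R]card_ord -sumr_const; apply: ler_sum => i _.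
by rewrite cmodM !cmodX mulr_ile1// ?exprn_ile1// ?exprn_ge0 ?cmod_ge0.
Qed.

Lemma cvg_expr (T : Type) (F : set_system T) {FF : Filter F} n
    (v : T -> R[i]) v0 : v @ F --> v0 -> (fun t => v t ^+ n) @ F --> v0 ^+ n.
Proof.
move=> vv0; elim: n => [|n IH].
  by under eq_fun do rewrite expr0; rewrite expr0; exact: cvg_cst.
by under eq_fun do rewrite exprS; rewrite exprS; exact: (cvgM vv0 IH).
Qed.

Lemma cvg_divdiff (T : Type) (F : set_system T) {FF : Filter F} n
    (v u : T -> R[i]) v0 u0 :
  v @ F --> v0 -> u @ F --> u0 ->
  (fun t => divdiff n (v t) (u t)) @ F --> divdiff n v0 u0.
Proof.
move=> vv0 uu0; rewrite /divdiff; elim: (index_enum _) => [|i r IH].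
  by under eq_fun do rewrite big_nil; rewrite big_nil; exact: cvg_cst.
under eq_fun do rewrite big_cons; rewrite big_cons.
have h : (fun t => v t ^+ (n.-1 - i) * u t ^+ i) @ F --> v0 ^+ (n.-1 - i) * u0 ^+ i.
  by apply: cvgM; exact: cvg_expr.
exact: (cvgD h IH).
Qed.

(** The exponents [e] stay general in order to serve both halves of g: [id] for k >= 0 and [succn]
    for k < 0. *)
Definition pows c e u : R[i] := cseries (fun n => c n * u ^+ e n).
Definition pows_divdiff c e v u : R[i] := cseries (fun n => c n * divdiff (e n) v u).

Section fixed.
Variables (c : nat -> R[i]) (e : nat -> nat).
Hypothesis c1 : abs_cvg c.
Hypothesis ce : cvgn (series (fun n => (e n)%:R * cmod (c n))).

Lemma pows_term_le u n : cmod u <= 1 -> cmod (c n * u ^+ e n) <= cmod (c n).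
Proof.
move=> u1; rewrite cmodM cmodX ler_piMr ?cmod_ge0//.
by rewrite exprn_ile1// cmod_ge0.
Qed.

Lemma pows_divdiff_term_le v u n : cmod v <= 1 -> cmod u <= 1 ->
  cmod (c n * divdiff (e n) v u) <= (e n)%:R * cmod (c n).
Proof.
by move=> v1 u1; rewrite cmodM mulrC ler_wpM2r ?cmod_ge0// cmod_divdiff.
Qed.

Lemma pows_term_cvg u : cmod u <= 1 -> abs_cvg (fun n => c n * u ^+ e n).
Proof.
move=> u1; apply: rseries_cvg_le c1 => n.
by rewrite ger0_norm ?cmod_ge0// pows_term_le.
Qed.

Lemma cmod_pows u : cmod u <= 1 -> cmod (pows c e u) <= rseries (fun n => cmod (c n)).
Proof. by move=> u1; apply: cseries_le => // n; exact: pows_term_le. Qed.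

Lemma cmod_pows_divdiff v u : cmod v <= 1 -> cmod u <= 1 ->
  cmod (pows_divdiff c e v u) <= rseries (fun n => (e n)%:R * cmod (c n)).
Proof. by move=> v1 u1; apply: cseries_le => // n; exact: pows_divdiff_term_le. Qed.

(** Each v^k - u^k is factored by [divdiff]; the hypothesis [ce] on the differentiated series makes
    the series of quotients absolutely convergent, so that v - u can be taken out. *)
Lemma powsB v u : cmod v <= 1 -> cmod u <= 1 ->
  pows c e v - pows c e u = (v - u) * pows_divdiff c e v u.
Proof.
move=> v1 u1; rewrite -cseriesZ; last first.
  apply: rseries_cvg_le ce => n.
  by rewrite ger0_norm ?cmod_ge0// pows_divdiff_term_le.
apply/eqP; rewrite subr_eq -cseriesD; last exact: pows_term_cvg.
- apply/eqP; congr cseries; apply/funext => n.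
  by rewrite /divdiff mulrCA -subrXX; ring.
- apply: abs_cvgZ; apply: rseries_cvg_le ce => n.
  by rewrite ger0_norm ?cmod_ge0// pows_divdiff_term_le.
Qed.

(** Tannery's theorem with the majorant [(e n)%:R * cmod (c n)], valid on the whole closed disk;
    [v0 = u0] on the unit circle is allowed. *)
Lemma cvg_pows_divdiff (T : Type) (F : set_system T) {FF : Filter F}
    (v u : T -> R[i]) v0 u0 :
  (forall t, cmod (v t) <= 1) -> (forall t, cmod (u t) <= 1) ->
  cmod v0 <= 1 -> cmod u0 <= 1 ->
  v @ F --> v0 -> u @ F --> u0 ->
  (fun t => pows_divdiff c e (v t) (u t)) @ F --> pows_divdiff c e v0 u0.
Proof.
move=> v1 u1 v01 u01 vv0 uu0.
apply: (cvg_cseries (u := fun n t => c n * divdiff (e n) (v t) (u t)) ce).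
- by move=> n t; exact: pows_divdiff_term_le.
- by move=> n; exact: pows_divdiff_term_le.
- by move=> n; apply: cvgMr; exact: cvg_divdiff.
Qed.

Lemma cvg_pows (T : Type) (F : set_system T) {FF : Filter F} (u : T -> R[i]) u0 :
  (forall t, cmod (u t) <= 1) -> cmod u0 <= 1 ->
  u @ F --> u0 -> (fun t => pows c e (u t)) @ F --> pows c e u0.
Proof.
move=> u1 u01 uu0.
apply: (cvg_cseries (u := fun n t => c n * u t ^+ e n) c1).
- by move=> n t; exact: pows_term_le.
- by move=> n; exact: pows_term_le.
- by move=> n; apply: cvgMr; exact: cvg_expr.
Qed.

End fixed.
End PowerSeries.

(** * Real differentiability in Wirtinger form *)

Section Wirtinger.
Variable R : realType.
Implicit Types (A B w z : R[i]) (f : R[i] -> R[i]).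

(** The real-linear map h -> A h + B conj h on R^2; when it is the differential of a function, [A]
    and [B] are the Wirtinger derivatives. *)
Definition wirtinger A B (h : R * R) : R * R :=
  ofC (A * toC h + B * (toC h)^*).

Lemma wirtinger_is_linear A B : linear (wirtinger A B).
Proof.
move=> k h1 h2; rewrite /wirtinger toCD.
have -> : toC (k *: h1) = k%:C * toC h1 by case: h1 => x y; apply/eqP; rewrite eq_complex /= !mul0r subr0 addr0 !eqxx.
have -> : (k%:C * toC h1 + toC h2)^* = k%:C * (toC h1)^* + (toC h2)^*.
  by rewrite rmorphD rmorphM [X in X * _]conjCE conjc_real.
have -> : k *: ofC (A * toC h1 + B * (toC h1)^*)
  = ofC (k%:C * (A * toC h1 + B * (toC h1)^*)).
  by case: (_ + _) => x y; rewrite /ofC /= !mul0r subr0 addr0.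
by rewrite -ofCD; congr ofC; ring.
Qed.

HB.instance Definition _ A B :=
  GRing.isLinear.Build R (R * R)%type (R * R)%type _ (wirtinger A B)
    (wirtinger_is_linear A B).

Lemma cvg_wirtinger (T : Type) (F : set_system T) {FF : Filter F}
    (A B : T -> R[i]) A0 B0 (h : T -> R * R) h0 :
  A @ F --> A0 -> B @ F --> B0 -> h @ F --> h0 ->
  (fun t => wirtinger (A t) (B t) (h t)) @ F --> wirtinger A0 B0 h0.
Proof.
move=> AA0 BB0 /cvg_toC hh0; apply: cvg_ofC; apply: (cvgD (cvgM AA0 hh0)).
exact: (cvgM BB0 (cvg_conjc hh0)).
Qed.

Lemma wirtinger_continuous A B : continuous (wirtinger A B).
Proof. by move=> p; exact: (cvg_wirtinger (cvg_cst A) (cvg_cst B) cvg_id). Qed.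

(* Caratheodory's criterion: continuity of the difference quotients at the
   diagonal gives differentiability and continuity of the derivative at once. *)
Lemma C1_on_caratheodory f (A B : R[i] -> R[i] -> R[i]) :
  (forall w z, f w - f z = A w z * (w - z) + B w z * (w - z)^*) ->
  (forall (F : set_system (R * R)) (w z : R * R -> R[i]) z0, Filter F ->
    w @ F --> z0 -> z @ F --> z0 ->
    (fun t => A (w t) (z t)) @ F --> A z0 z0 /\
    (fun t => B (w t) (z t)) @ F --> B z0 z0) ->
  C1_on setT f.
Proof.
move=> fE cAB; rewrite /C1_on; set G := @ofC R \o f \o @toC R.
pose V : normedModType R := (R * R)%type.
have GE (p : V) : (G : V -> V) \o shift p =
    cst (G p) + (wirtinger (A (toC p) (toC p)) (B (toC p) (toC p)) : V -> V) +o_ (0 : V) id.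
  set z := toC p.
  apply/eqaddoP => eps eps0.
  have cw : toC (h + p) @[h --> 0] --> z.
    apply: cvg_toC; rewrite -[X in _ --> X]add0r.
    exact: (cvgD cvg_id (cvg_cst p)).
  have [cA cB] := cAB (nbhs (0 : R * R)) (fun h => toC (h + p)) (fun=> z) z _ cw (cvg_cst _).
  (* Two coefficients, each within [eps / 4], and the factor 2 of [toC_norm] give [eps]. *)
  have e4 : 0 < eps / 4 by rewrite divr_gt0.
  move/cvg_cmodP/(_ _ e4): cA => cA; move/cvg_cmodP/(_ _ e4): cB => cB.
  near=> h.
  have hA : cmod (A (toC (h + p)) z - A z z) < eps / 4 by near: h.
  have hB : cmod (B (toC (h + p)) z - B z z) < eps / 4 by near: h.
  have -> : (G \o shift p - (cst (G p) + wirtinger (A z z) (B z z))) h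
    = ofC ((A (toC (h + p)) z - A z z) * toC h + (B (toC (h + p)) z - B z z) * (toC h)^*).
    have E : f (toC (h + p)) = f z + (A (toC (h + p)) z * toC h + B (toC (h + p)) z * (toC h)^*).
      have -> : toC h = toC (h + p) - z by rewrite toCD addrK.
      by rewrite -fE; ring.
    rewrite -[LHS]/(ofC (f (toC (h + p))) - (ofC (f z) + wirtinger (A z z) (B z z) h)) E ofCD.
    have ofCN x : - ofC x = ofC (- x) by rewrite /ofC ReN ImN.
    by rewrite /wirtinger -!ofCD ofCN -ofCD; congr ofC; ring.
  rewrite (le_trans (ofC_norm _))// (le_trans (cmodD _ _))// !cmodM cmodJ -mulrDl.
  rewrite (le_trans (ler_wpM2l _ (toC_norm h)))// ?addr_ge0 ?cmod_ge0//.
  rewrite mulrA ler_wpM2r//; lra.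
(* The differential is now explicit at every point, so its continuity becomes convergence of [A] and
   [B] along the diagonal. *)
have dG p := diff_unique (@wirtinger_continuous _ _) (GE p).
split=> [p _|v p _].
  by apply/diff_locallyP; rewrite dG; split; [exact: wirtinger_continuous|exact: GE].
have -> : (fun q => 'd G q v) = (fun q => wirtinger (A (toC q) (toC q)) (B (toC q) (toC q)) v).
  by apply/funext => q; rewrite (dG q).
have ct : toC q @[q --> p] --> toC p by apply: cvg_toC; exact: cvg_id.
have [cA cB] := cAB (nbhs p) (@toC R) (@toC R) (toC p) _ ct ct.
exact: (cvg_wirtinger cA cB (cvg_cst v)).
Unshelve. all: by end_near. Qed.

End Wirtinger.

(** * C^1 regularity of a power of z times a function of conj z / z *)

Section HomogeneousC1.
Variable R : realType.
Variables (c d : nat -> R[i]) (n : nat).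
Hypothesis c1 : abs_cvg c.
Hypothesis ce : cvgn (series (fun k => k%:R * cmod (c k))).
Hypothesis d1 : abs_cvg d.
Hypothesis de : cvgn (series (fun k => k.+1%:R * cmod (d k))).
Implicit Types w z : R[i].

(* Bounded by 1 everywhere, as [0 / 0 = 0]. *)
Definition dir z : R[i] := z^* / z.

(** This is H(u) at u = conj z / z, with the negative powers of u written as positive powers of conj
    u, which keeps every term bounded even at z = 0. *)
Definition profile z : R[i] := pows c id (dir z) + pows d succn (dir z)^*.

(* The exponent is at least 2, so that the difference quotients below are
   continuous even at 0, where [profile] is not. *)
Definition homog z : R[i] := z ^+ n.+2 * profile z.

Let Kc w z := pows_divdiff c id (dir w) (dir z).
Let Kd w z := pows_divdiff d succn (dir w)^* (dir z)^*.
Let Mc := rseries (fun k => k%:R * cmod (c k)).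
Let Md := rseries (fun k => k.+1%:R * cmod (d k)).
Let Bc := rseries (fun k => cmod (c k)).
Let Bd := rseries (fun k => cmod (d k)).

(* Coefficients of [w - z] and [(w - z)^*] in [homog w - homog z]; on the
   diagonal they are the Wirtinger derivatives. *)
Definition homog_dz w z : R[i] :=
  w ^+ n.+2 * (Kd w z / w^* - Kc w z * (z^* / (w * z)))
  + divdiff n.+2 w z * profile z.

Definition homog_dzbar w z : R[i] :=
  w ^+ n.+2 * (Kc w z / w - Kd w z * (z / (w^* * z^*))).

Lemma dir_eq1 z : z != 0 -> cmod (dir z) = 1.
Proof. by move=> z0; rewrite /dir cmodM cmodV cmodJ mulfV// cmod_eq0. Qed.

Lemma dir_le1 z : cmod (dir z) <= 1.
Proof.
have [->|z0] := eqVneq z 0; first by rewrite /dir invr0 mulr0 cmod0.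
by rewrite dir_eq1.
Qed.

Lemma dirJ_le1 z : cmod (dir z)^* <= 1.
Proof. by rewrite cmodJ dir_le1. Qed.

Lemma dirJ z : (dir z)^* = z / z^*.
Proof. by rewrite /dir rmorphM /= fmorphV conjCK. Qed.

Lemma profileB w z : profile w - profile z =
  (dir w - dir z) * Kc w z + ((dir w)^* - (dir z)^*) * Kd w z.
Proof.
rewrite -(powsB c1 ce (dir_le1 _) (dir_le1 _)).
rewrite -(powsB (e := succn) d1 de (dirJ_le1 _) (dirJ_le1 _)).
by rewrite /profile opprD addrACA.
Qed.

(** Product rule for differences, combined with conj w / w - conj z / z = conj (w - z) / w - (w - z)
    conj z / (w z) and its conjugate. *)
Lemma homogB w z : homog w - homog z =
  homog_dz w z * (w - z) + homog_dzbar w z * (w - z)^*.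
Proof.
have -> : homog w - homog z = w ^+ n.+2 * (profile w - profile z)
    + (w - z) * divdiff n.+2 w z * profile z.
  by rewrite /divdiff -subrXX /homog mulrBr mulrBl addrA subrK.
rewrite profileB !dirJ /dir rmorphB /= /homog_dz /homog_dzbar.
move: (Kc w z) (Kd w z) (divdiff _ _ _) (profile z) => K L D P.
(* The identity is required at 0 too: for [w = 0] the power of [w] vanishes, and for [z = 0] the
   convention that 0 has inverse 0 fits the formula. *)
have [->|w0] := eqVneq w 0.
  by rewrite expr0n /= !mul0r !add0r addr0 -mulrA [RHS]mulrC.
have w0' : w^* != 0 by rewrite conjC_eq0.
move: (w ^+ _) => W; have [->|z0] := eqVneq z 0.
  rewrite conjC0 invr0 !mul0r !mulr0 !subr0.
  move: (w^*) w0' => w' w0'. by field; exact/andP.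
have z0' : z^* != 0 by rewrite conjC_eq0.
move: (w^*) w0' (z^*) z0' => w' w0' z' z0'.
by field; rewrite w0 w0' z0 z0'.
Qed.

Lemma cmod_profile z : cmod (profile z) <= Bc + Bd.
Proof.
rewrite (le_trans (cmodD _ _))// lerD//.
- exact: cmod_pows (dir_le1 _).
- exact: cmod_pows (dirJ_le1 _).
Qed.

(** Each term loses one power of w to a division, and the remaining quotient has modulus at most 1.
    The bound is uniform in [z] and tends to 0 with [w]; it is written as a modulus to suit
    [cvg_cmod_le0]. *)
Lemma cmod_homog_dz_main w z :
  cmod (w ^+ n.+2 * (Kd w z / w^* - Kc w z * (z^* / (w * z))))
    <= cmod (((Mc + Md)%:C : R[i]) * w ^+ n.+1).
Proof.
have K1 : cmod (Kc w z) <= Mc by apply: cmod_pows_divdiff => //; exact: dir_le1.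
have K2 : cmod (Kd w z) <= Md.
  by apply: (cmod_pows_divdiff (e := succn)) => //; exact: dirJ_le1.
have K10 : 0 <= cmod (Kc w z) by exact: cmod_ge0.
have K20 : 0 <= cmod (Kd w z) by exact: cmod_ge0.
rewrite [leRHS]cmodM cmodR ger0_norm; last by lra.
have -> : w ^+ n.+2 * (Kd w z / w^* - Kc w z * (z^* / (w * z)))
    = w ^+ n.+2 * (Kd w z / w^*) - w ^+ n.+2 / w * (Kc w z * dir z).
  by rewrite /dir invfM; ring.
(* Also true at [x = 0], where both sides vanish. *)
have xV (x : R) : x ^+ n.+2 * x^-1 = x ^+ n.+1.
  by have [->|x0] := eqVneq x 0; [rewrite !expr0n mul0r|rewrite exprSr mulfK].
rewrite (le_trans (cmodD _ _))// cmodN !cmodM !cmodV !cmodX cmodJ.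
rewrite (mulrCA (cmod w ^+ n.+2)) xV mulrDl addrC lerD//.
  rewrite mulrC ler_wpM2r ?exprn_ge0 ?cmod_ge0//.
  by rewrite (le_trans _ K1)// ler_piMr//; have := dir_le1 z; rewrite cmodM cmodV cmodJ.
by rewrite ler_wpM2r ?exprn_ge0 ?cmod_ge0.
Qed.

Lemma cmod_homog_dzbar w z :
  cmod (homog_dzbar w z) <= cmod (((Mc + Md)%:C : R[i]) * w ^+ n.+1).
Proof.
have K1 : cmod (Kc w z) <= Mc by apply: cmod_pows_divdiff => //; exact: dir_le1.
have K2 : cmod (Kd w z) <= Md.
  by apply: (cmod_pows_divdiff (e := succn)) => //; exact: dirJ_le1.
have K10 : 0 <= cmod (Kc w z) by exact: cmod_ge0.
have K20 : 0 <= cmod (Kd w z) by exact: cmod_ge0.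
rewrite [leRHS]cmodM cmodR ger0_norm; last by lra.
have -> : homog_dzbar w z
    = w ^+ n.+2 * (Kc w z / w) - w ^+ n.+2 / w^* * (Kd w z * (dir z)^*).
  by rewrite /homog_dzbar dirJ invfM; ring.
have xV (x : R) : x ^+ n.+2 * x^-1 = x ^+ n.+1.
  by have [->|x0] := eqVneq x 0; [rewrite !expr0n mul0r|rewrite exprSr mulfK].
rewrite (le_trans (cmodD _ _))// cmodN !cmodM !cmodV !cmodX !cmodJ.
rewrite (mulrCA (cmod w ^+ n.+2)) xV mulrDl lerD//.
  by rewrite ler_wpM2r ?exprn_ge0 ?cmod_ge0.
rewrite mulrC ler_wpM2r ?exprn_ge0 ?cmod_ge0//.
by rewrite (le_trans _ K2)// ler_piMr// dir_le1.
Qed.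

Lemma divdiff00 : divdiff n.+2 0 0 = 0 :> R[i].
Proof.
rewrite /divdiff big1// => i _.
by case: i => [[|i]] /= _; rewrite ?expr0n /= ?mul0r ?mulr0.
Qed.

Lemma homog_dz00 : homog_dz 0 0 = 0.
Proof. by rewrite /homog_dz expr0n mul0r add0r divdiff00 mul0r. Qed.

Section limits.
Variables (T : Type) (F : set_system T) (w z : T -> R[i]) (z0 : R[i]).
Context {FF : Filter F}.
Hypotheses (wz0 : w @ F --> z0) (zz0 : z @ F --> z0).

Let cvg_pow0 : z0 = 0 ->
  (fun t => (((Mc + Md)%:C : R[i]) * w t ^+ n.+1)) @ F --> (0 : R[i]).
Proof.
move=> e; have E : ((Mc + Md)%:C : R[i]) * z0 ^+ n.+1 = 0.
  by rewrite e expr0n /= mulr0.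
rewrite -[X in _ --> X]E.
exact: (cvgM (cvg_cst _) (cvg_expr wz0)).
Qed.

Lemma cvg_dir (v : T -> R[i]) : z0 != 0 -> v @ F --> z0 ->
  (fun t => dir (v t)) @ F --> dir z0.
Proof. by move=> z00 vz0; apply: cvgM; [exact: cvg_conjc|exact: cvgV]. Qed.

(** At the origin [profile] is bounded but need not have a limit, and the bounds above force the
    limit 0. Elsewhere [dir] is continuous, and the limit is taken factor by factor. *)
Lemma cvg_homog_dz : (fun t => homog_dz (w t) (z t)) @ F --> homog_dz z0 z0.
Proof.
have [e|z00] := eqVneq z0 0.
  rewrite e homog_dz00 -[X in _ --> X]addr0; apply: cvgD.
    apply: cvg_cmod_le0 (cvg_pow0 e) => t; exact: cmod_homog_dz_main.
  have E : ((Bc + Bd)%:C : R[i]) * divdiff n.+2 z0 z0 = 0.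
    by rewrite e divdiff00 mulr0.
  have cd : (fun t => ((Bc + Bd)%:C : R[i]) * divdiff n.+2 (w t) (z t)) @ F --> (0 : R[i]).
    rewrite -[X in _ --> X]E.
    exact: (cvgM (cvg_cst _) (cvg_divdiff wz0 zz0)).
  apply: cvg_cmod_le0 cd => t.
  rewrite !cmodM mulrC cmodR ler_wpM2r ?cmod_ge0//.
  by rewrite (le_trans (cmod_profile _))// ler_norm.
have z00' : z0^* != 0 by rewrite conjC_eq0.
have cdw := cvg_dir z00 wz0; have cdz := cvg_dir z00 zz0.
have cK := cvg_pows_divdiff (FF := FF) ce (fun t => dir_le1 (w t)) (fun t => dir_le1 (z t))
  (dir_le1 z0) (dir_le1 z0) cdw cdz.
have cL := cvg_pows_divdiff (FF := FF) (e := succn) de (fun t => dirJ_le1 (w t)) (fun t => dirJ_le1 (z t))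
  (dirJ_le1 z0) (dirJ_le1 z0) (cvg_conjc (FF := FF) cdw) (cvg_conjc (FF := FF) cdz).
have cP : (fun t => profile (z t)) @ F --> profile z0.
  apply: cvgD.
    exact: (cvg_pows c1 (fun t => dir_le1 (z t)) (dir_le1 z0) cdz).
  exact: (cvg_pows d1 (fun t => dirJ_le1 (z t)) (dirJ_le1 z0) (cvg_conjc (FF := FF) cdz)).
have cw' := cvg_conjc (FF := FF) wz0; have cz' := cvg_conjc (FF := FF) zz0.
have cV : (fun t => (w t * z t)^-1) @ F --> (z0 * z0)^-1.
  exact: (cvgV (mulf_neq0 z00 z00) (cvgM wz0 zz0)).
apply: (cvgD _ (cvgM (cvg_divdiff wz0 zz0) cP)).
have h1 : (fun t => Kd (w t) (z t) / (w t)^*) @ F --> Kd z0 z0 / z0^*.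
  exact: (cvgM cL (cvgV z00' cw')).
have h2 : (fun t => Kc (w t) (z t) * ((z t)^* / (w t * z t))) @ F -->
    Kc z0 z0 * (z0^* / (z0 * z0)) by exact: (cvgM cK (cvgM cz' cV)).
have h3 : (fun t => Kd (w t) (z t) / (w t)^* - Kc (w t) (z t) * ((z t)^* / (w t * z t))) @ F
    --> Kd z0 z0 / z0^* - Kc z0 z0 * (z0^* / (z0 * z0)) by exact: (cvgB h1 h2).
by apply: (cvgM _ h3); exact: cvg_expr.
Qed.

Lemma cvg_homog_dzbar :
  (fun t => homog_dzbar (w t) (z t)) @ F --> homog_dzbar z0 z0.
Proof.
have [e|z00] := eqVneq z0 0.
  rewrite {2}/homog_dzbar e expr0n mul0r.
  apply: cvg_cmod_le0 (cvg_pow0 e) => t; exact: cmod_homog_dzbar.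
have z00' : z0^* != 0 by rewrite conjC_eq0.
have cdw := cvg_dir z00 wz0; have cdz := cvg_dir z00 zz0.
have cK := cvg_pows_divdiff (FF := FF) ce (fun t => dir_le1 (w t)) (fun t => dir_le1 (z t))
  (dir_le1 z0) (dir_le1 z0) cdw cdz.
have cL := cvg_pows_divdiff (FF := FF) (e := succn) de (fun t => dirJ_le1 (w t)) (fun t => dirJ_le1 (z t))
  (dirJ_le1 z0) (dirJ_le1 z0) (cvg_conjc (FF := FF) cdw) (cvg_conjc (FF := FF) cdz).
have cw' := cvg_conjc (FF := FF) wz0; have cz' := cvg_conjc (FF := FF) zz0.
have cV : (fun t => ((w t)^* * (z t)^*)^-1) @ F --> (z0^* * z0^*)^-1.
  exact: (cvgV (mulf_neq0 z00' z00') (cvgM cw' cz')).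
have h1 : (fun t => Kc (w t) (z t) / w t) @ F --> Kc z0 z0 / z0.
  exact: (cvgM cK (cvgV z00 wz0)).
have h2 : (fun t => Kd (w t) (z t) * (z t / ((w t)^* * (z t)^*))) @ F -->
    Kd z0 z0 * (z0 / (z0^* * z0^*)) by exact: (cvgM cL (cvgM zz0 cV)).
have h3 : (fun t => Kc (w t) (z t) / w t - Kd (w t) (z t) * (z t / ((w t)^* * (z t)^*))) @ F
    --> Kc z0 z0 / z0 - Kd z0 z0 * (z0 / (z0^* * z0^*)) by exact: (cvgB h1 h2).
by apply: (cvgM _ h3); exact: cvg_expr.
Qed.

End limits.

Lemma C1_on_homog : C1_on setT homog.
Proof.
apply: (C1_on_caratheodory homogB) => F w z z0 FF wz0 zz0.
by split; [exact: cvg_homog_dz|exact: cvg_homog_dzbar].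
Qed.

End HomogeneousC1.

(** * The function g: expansion, symmetries, regularity and values on the circle *)

Section Coefficients.
Variable R : realType.
Implicit Types (b : int -> R[i]) (z u : R[i]).

Lemma cmod_exprz u (k : int) : cmod (u ^ k) = cmod u ^ k.
Proof. by case: k => n; rewrite /exprz ?cmodV cmodX. Qed.

Lemma zsumCZ z b : zcvg (fun k => cmod (b k)) ->
  zsumC (fun k => z * b k) = z * zsumC b.
Proof. by move=> [cp cn]; rewrite /zsumC !cseriesZ// mulrDr. Qed.

Lemma zcvg_le (v w : int -> R) : (forall k, `|v k| <= w k) -> zcvg w -> zcvg v.
Proof.
by move=> vw [wp wn]; split; [apply: rseries_cvg_le wp|apply: rseries_cvg_le wn].
Qed.

(** Shifting by [l] and folding pairs the indices l + n and l - n, the pairing used in [bcoef]. *)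
Lemma zsumR_recenter (v : int -> R) (l : int) : zcvg v ->
  zsumR v = v l + rseries (fun n => v (l + n.+1%:Z) + v (l - n.+1%:Z)).
Proof.
move=> cv; have [cv' <-] := zsumR_shift l cv.
rewrite (zsumR_fold cv') add0r; congr (_ + rseries _); apply/funext => n.
by rewrite addrC [X in v X + _]addrC [X in _ + v X]addrC addrC.
Qed.

Lemma zcvg_recenter (v : int -> R) (l : int) : zcvg v ->
  cvgn (series (fun n => v (l + n.+1%:Z) + v (l - n.+1%:Z))).
Proof.
move=> cv; have [[cp cn] _] := zsumR_shift l cv.
have [cp' _] := rseries_recl cp.
rewrite (_ : (fun n => _) = (fun n => v (n.+1%:Z + l) + v (- n.+1%:Z + l))).
  exact: cvg_seriesD cp' cn.
by apply/funext => n; rewrite ![l + _]addrC.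
Qed.

Lemma Re_zsumC_recenter b (l : int) : zcvg (fun k => cmod (b k)) ->
  complex.Re (zsumC b) = complex.Re (b l) +
    rseries (fun n => complex.Re (b (l + n.+1%:Z)) + complex.Re (b (l - n.+1%:Z))).
Proof.
move=> cb; rewrite zsumC_Re (zsumR_recenter (v := fun k => complex.Re (b k)) l)//.
by apply: zcvg_le cb => k; exact: Re_le_cmod.
Qed.

Variable a : int -> R[i].
Hypothesis ha : zsummable (fun k : int => cmod (k%:~R * a k)).

Let pos (n : nat) := a n%:Z.
Let neg (n : nat) := a (- n.+1%:Z).

Lemma pos_deriv_cvg : cvgn (series (fun n => n%:R * cmod (pos n))).
Proof.
have [+ _] := ha => /nneseries_cvg_series h.
rewrite (_ : (fun n => _) = (fun n : nat => cmod (n%:Z%:~R * a n%:Z))).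
  exact: h (fun=> cmod_ge0 _).
by apply/funext => n; rewrite cmodM -(cmod_nat R n).
Qed.

Lemma neg_deriv_cvg : cvgn (series (fun n => n.+1%:R * cmod (neg n))).
Proof.
have [_ +] := ha => /nneseries_cvg_series h.
rewrite (_ : (fun n => _) = (fun n : nat => cmod ((- n.+1%:Z)%:~R * a (- n.+1%:Z)))).
  exact: h (fun=> cmod_ge0 _).
by apply/funext => n; rewrite cmodM mulrNz cmodN -(cmod_nat R n.+1).
Qed.

Lemma zcvg_coef : zcvg (fun k => cmod (a k)).
Proof.
split; last first.
  apply: rseries_cvg_le neg_deriv_cvg => n.
  by rewrite ger0_norm ?cmod_ge0// ler_peMl ?cmod_ge0// ler1n.
(* The summability of |k a_k| says nothing about a_0, so the term k = 0 is split off before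
   comparing. *)
apply: cvg_series_recl.
have [h _] := rseries_recl pos_deriv_cvg.
apply: rseries_cvg_le h => n.
by rewrite ger0_norm ?cmod_ge0// ler_peMl ?cmod_ge0// ler1n.
Qed.

Lemma zcvg_coef_circle u : cmod u = 1 -> zcvg (fun k => cmod (a k * u ^ k)).
Proof.
move=> u1; apply: zcvg_le zcvg_coef => k.
by rewrite ger0_norm ?cmod_ge0// cmodM cmod_exprz u1 exp1rz mulr1.
Qed.

Lemma profileE z : z != 0 -> profile pos neg z = zsumC (fun k => a k * dir z ^ k).
Proof.
move=> z0; rewrite /profile /zsumC; congr (_ + _).
congr cseries; apply/funext => n; congr (_ * _).
have -> : (dir z)^* = (dir z)^-1 by rewrite dirJ /dir invf_div.
by rewrite exprVn.
Qed.

(** Factors conj z^k z^(2m-k) as z^(2m) (conj z / z)^k; [0 < m] makes the exponent at least 2, as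
    [homog] requires. *)
Lemma gfunE m : (0 < m)%N -> gfun m a = homog pos neg (2 * m).-2.
Proof.
move=> m0; have m2 : (2 * m).-2.+2 = (2 * m)%N by lia.
apply/funext => z; rewrite /gfun /homog m2.
case: eqVneq => [->|z0]; first by rewrite expr0n muln_eq0 -[m == 0%N]negbK -lt0n m0 mul0r.
rewrite profileE// -zsumCZ; last by apply: zcvg_coef_circle; rewrite dir_eq1.
congr zsumC; apply/funext => k.
rewrite /dir expfzMl exprz_inv expfzDr// exprnP.
by move: (z^* ^ k) (z ^ _) (z ^ (- k)) (a k) => x y t ak; ring.
Qed.

Lemma gfun_profile m z : (0 < m)%N ->
  gfun m a z = z ^+ (2 * m) * profile pos neg z.
Proof.
move=> m0; have m2 : (2 * m).-2.+2 = (2 * m)%N by lia.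
by rewrite gfunE// /homog m2.
Qed.

Lemma gfunN m z : (0 < m)%N -> gfun m a (- z) = gfun m a z.
Proof.
move=> m0; rewrite !(gfun_profile _ m0) /profile.
have -> : dir (- z) = dir z by rewrite /dir rmorphN invrN mulrNN.
by rewrite exprM sqrrN -exprM.
Qed.

Lemma gfunZ m (t : R) z : (0 < m)%N -> 0 < t ->
  gfun m a (t%:C * z) = (t ^+ (2 * m))%:C * gfun m a z.
Proof.
move=> m0 t0; rewrite !(gfun_profile _ m0) /profile.
have -> : dir (t%:C * z) = dir z.
  have -> : dir (t%:C * z) = (t%:C * z^*) / (t%:C * z).
    by rewrite /dir rmorphM /= [(t%:C : R[i])^*]conjCE conjc_real.
  rewrite -mulf_div divff ?mul1r//.
  by rewrite -cmod_eq0 cmodR normr_eq0 gt_eqF.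
by rewrite exprMn rmorphXn mulrA.
Qed.

Lemma C1_gfun m : (0 < m)%N -> C1_on setT (gfun m a).
Proof.
move=> m0; rewrite gfunE//; have [cp cn] := zcvg_coef.
exact: (C1_on_homog _ cp pos_deriv_cvg cn neg_deriv_cvg).
Qed.

Lemma gfun_bound m : (0 < m)%N -> exists M : R, 0 < M /\
  forall z, cmod (gfun m a z) <= M * cmod z ^+ (2 * m).
Proof.
move=> m0; have [cp cn] := zcvg_coef.
(* The added 1 keeps the constant positive even when all coefficients vanish. *)
exists (rseries (fun k => cmod (pos k)) + rseries (fun k => cmod (neg k)) + 1).
have p0 := rseries_ge0 (fun n => cmod_ge0 (pos n)) cp.
have n0 := rseries_ge0 (fun n => cmod_ge0 (neg n)) cn.
split=> [|z]; first by lra.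
rewrite gfun_profile//.
rewrite cmodM cmodX mulrC ler_wpM2r ?exprn_ge0 ?cmod_ge0//.
by rewrite (le_trans (cmod_profile cp cn _))// lerDl.
Qed.

(** On the circle conj z = 1/z and u = z^(-2), so conj z^(2(m-l)) z^(2m) = u^(-l) and the left side
    is the real part of the sum of (a_k / a_l) u^(k-l). Pairing k = l + n with k = l - n gives the
    series of condition (iii). The assumption [l <= m] makes the absolute value equal to m - l. *)
Lemma Re_gfun_circle m (l : int) z : (0 < m)%N -> l <= m%:Z -> a l != 0 ->
  cmod z = 1 ->
  complex.Re (z^* ^+ (2 * `|m%:Z - l|) * gfun m a z / a l) =
  complex.Re (1 + cseries (fun n => bcoef a l n.+1 * dir z ^+ n.+1)).
Proof.
move=> m0 lm al0 z1.
have z0 : z != 0 by rewrite -cmod_gt0 z1.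
have zz : z * z^* = 1 by rewrite -normCK normc_cmod z1 expr1n.
have zJ : z^* = z^-1 by rewrite -[RHS]mulr1 -zz mulKf.
set u := dir z; have u1 : cmod u = 1 by exact: dir_eq1.
have u0 : u != 0 by rewrite -cmod_gt0 u1.
have uE : u = z ^ (- 2%:Z) by rewrite /u /dir zJ -invfM.
have Eg : z^* ^+ (2 * `|m%:Z - l|) * gfun m a z / a l
    = zsumC (fun k => u ^ (- l) / a l * (a k * u ^ k)).
  rewrite zsumCZ; last exact: zcvg_coef_circle.
  rewrite gfun_profile//.
  rewrite profileE// -/u mulrA [RHS]mulrAC; congr (_ * _ / _).
  have -> : z^* ^+ (2 * `|m%:Z - l|) = z ^ (- (2 * `|m%:Z - l|)%:Z).
    by rewrite zJ exprVn exprnN.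
  rewrite uE (exprnP z) -expfzDr// exprz_exp.
  by congr (_ ^ _); lia.
have cb : zcvg (fun k => cmod (u ^ (- l) / a l * (a k * u ^ k))).
  have [cp cn] := zcvg_coef_circle u1.
  by split; under eq_fun do rewrite cmodM; exact: cvg_seriesZ.
have uD k : u ^ (l + k) = u ^ l * u ^ k by rewrite expfzDr.
have ul0 : u ^ l != 0 by rewrite expfz_neq0.
rewrite Eg (Re_zsumC_recenter l cb) -invr_expz ReD; congr (_ + _).
  have -> // : (u ^ l)^-1 / a l * (a l * u ^ l) = 1.
  by move: (u ^ l) (a l) ul0 al0 => x y x0 y0; field; rewrite x0 y0.
congr rseries; apply/funext => n; rewrite !uD /bcoef mulrDl ReD.
congr (_ + _).
  congr complex.Re; move: (u ^ l) (a l) ul0 al0 => x y x0 y0.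
  by rewrite -exprnP; field; rewrite x0 y0.
have uJ : u^* = u^-1 by rewrite /u dirJ /dir invf_div.
(* Only real parts matter, so the term of index l - n may be conjugated, which turns u^(-n) into
   u^n; this is the source of the conjugates in [bcoef]. *)
have -> : (a (l - n.+1%:Z))^* / (a l)^* * u ^+ n.+1 = (a (l - n.+1%:Z) / a l * u ^ (- n.+1%:Z))^*.
  by rewrite !rmorphM /= fmorphV -exprnN fmorphV rmorphXn /= uJ exprVn invrK.
rewrite ReJ; congr complex.Re.
move: (u ^ l) (u ^ (- _)) (a l) ul0 al0 => x y t x0 t0.
by field; rewrite x0 t0.
Qed.

End Coefficients.

(** * Condition (i) implies (ii), and (ii) implies (iii) *)

Section Conditions.
Variable R : realType.
Variables (a : int -> R[i]) (l : int).
Hypothesis ha : zsummable (fun k : int => cmod (k%:~R * a k)).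

Let tail n := cmod (a (l + n.+1%:Z)) + cmod (a (l - n.+1%:Z)).

Let tail_cvg : cvgn (series tail).
Proof.
exact: (zcvg_recenter (l := l) (zcvg_coef ha)).
Qed.

Lemma cmod_bcoef n : cmod (bcoef a l n.+1) <= (cmod (a l))^-1 * tail n.
Proof.
rewrite /bcoef (le_trans (cmodD _ _))// !cmodM !cmodV !cmodJ /tail mulrDr.
by rewrite lerD// mulrC.
Qed.

Lemma bcoef_cvg : cvgn (series (fun n => cmod (bcoef a l n.+1))).
Proof.
apply: (rseries_cvg_le (s := fun n => (cmod (a l))^-1 * tail n)); last first.
  exact: cvg_seriesZ tail_cvg.
move=> n.
by rewrite ger0_norm ?cmod_ge0// cmod_bcoef.
Qed.

(** By the triangle inequality the sum of the |[bcoef]| is at most the sum of |a_n| over n != l,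
    divided by |a_l|. *)
Lemma bcoef_dominant :
  zsumR (fun n => if n == l then 0 else cmod (a n)) < cmod (a l) ->
  rseries (fun n => cmod (bcoef a l n.+1)) < 1.
Proof.
set v := fun _ => _; have cv : zcvg v.
  apply: zcvg_le (zcvg_coef ha) => k; rewrite /v.
  by case: ifP => _; rewrite ?normr0 ?cmod_ge0 ?ger0_norm ?cmod_ge0.
have -> : zsumR v = rseries tail.
  rewrite (zsumR_recenter l cv) {1}/v eqxx add0r; congr rseries; apply/funext => n.
  by rewrite /v /tail !ifN//; lia.
move=> lt; have t0 n : 0 <= tail n by rewrite addr_ge0 ?cmod_ge0.
have al0 : 0 < cmod (a l) by apply: le_lt_trans lt; exact: rseries_ge0 t0 tail_cvg.
apply: (@le_lt_trans _ _ ((cmod (a l))^-1 * rseries tail)).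
  rewrite -(rseriesZ _ tail_cvg); apply: rseries_le; last exact: cvg_seriesZ tail_cvg.
  by move=> n; rewrite cmod_ge0 cmod_bcoef.
by rewrite mulrC ltr_pdivrMr// mul1r.
Qed.

(** For |w| = 1 the series has modulus below 1, and Re (1 + S) >= 1 - |S|. *)
Lemma bcoef_Re_gt0 : rseries (fun n => cmod (bcoef a l n.+1)) < 1 ->
  forall w : R[i], cmod w = 1 ->
  0 < complex.Re (1 + cseries (fun n => bcoef a l n.+1 * w ^+ n.+1)).
Proof.
move=> b1 w w1; rewrite ReD (_ : complex.Re 1 = 1)//.
set S := cseries _.
have : cmod S <= rseries (fun n => cmod (bcoef a l n.+1)).
  by apply: cseries_le bcoef_cvg => n; rewrite cmodM cmodX w1 expr1n mulr1.
have := Re_le_cmod S; rewrite ler_norml => /andP[]; lra.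
Qed.

End Conditions.

(** * Lower bound by compactness of the circle and homogeneity *)

Section LowerBound.
Variable R : realType.

(** A closed subset of the compact square [-1, 1]^2. *)
Lemma circle_compact : compact [set p : R * R | cmod (toC p) = 1].
Proof.
apply: (@subclosed_compact _ _ ((`[-1, 1]%classic : set R) `*` (`[-1, 1]%classic : set R))).
- rewrite (_ : [set p | _] = (fun p => cmod (toC p)) @^-1` [set 1])//.
  apply: closed_comp; last exact: closed_eq.
  move=> p _; apply/cvgrPdist_lt => e e0.
  have ct : toC q @[q --> p] --> toC p by apply: cvg_toC; exact: cvg_id.
  move/cvg_cmodP/(_ _ e0): ct.
  apply: filterS => q; apply: le_lt_trans.
  have h1 := cmodD (toC p - toC q) (toC q).
  have h2 := cmodD (toC q - toC p) (toC p).
  rewrite !subrK [cmod (toC p - toC q)]cmodBC in h1 h2.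
  rewrite ler_norml; lra.
- by apply: compact_setX; exact: segment_compact.
- move=> p /= p1; have := Re_le_cmod (toC p); have := Im_le_cmod (toC p).
  by rewrite p1 !ler_norml /= !in_itv /=.
Qed.

Lemma circle_min (f : R[i] -> R) :
  (forall p : R * R, (fun q => f (toC q)) @ p --> f (toC p)) ->
  (forall z, cmod z = 1 -> 0 < f z) ->
  exists2 c : R, 0 < c & forall z, cmod z = 1 -> c <= f z.
Proof.
move=> cf f0.
have [||p /= p1 pmin] := @compact_EVT_min (R * R)%type R (fun q => f (toC q)) _ _ circle_compact.
- by exists (1, 0); rewrite /= -[RHS](cmod1 R).
- by apply: continuous_subspaceT => q; exact: cf.
move: p1; rewrite inE => p1; exists (f (toC p)) => [|z z1]; first exact: f0.
by have := pmin (ofC z); rewrite inE /= ofCK; apply.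
Qed.

Lemma C1_on_cvg (f : R[i] -> R[i]) : C1_on setT f ->
  forall p : R * R, (fun q => f (toC q)) @ p --> f (toC p).
Proof.
move=> [df _] p; have /differentiable_continuous := df p I.
move=> /cvg_toC; rewrite /= ofCK.
by under eq_fun do rewrite ofCK; apply.
Qed.

(** The constant is the minimum over the unit circle; writing z = |z| y with |y| = 1 scales the
    expression by |z|^(N + k). *)
Lemma homogeneous_Re_lower_bound (g : R[i] -> R[i]) (b : R[i]) (N k : nat) :
  (0 < k)%N -> C1_on setT g ->
  (forall (t : R) z, 0 < t -> g (t%:C * z) = (t ^+ k)%:C * g z) ->
  (forall z, cmod z = 1 -> 0 < complex.Re (z^* ^+ N * g z / b)) ->
  exists2 c : R, 0 < c & forall z, z != 0 ->
    c * cmod z ^+ (N + k) <= complex.Re (z^* ^+ N * g z / b).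
Proof.
move=> k0 g1 gh gpos.
have [|c c0 cmin] := circle_min _ gpos.
  move=> p; apply: (cvg_Re (f := fun q => (toC q)^* ^+ N * g (toC q) / b)).
  have h1 : (fun q => (toC q)^* ^+ N) @ p --> (toC p)^* ^+ N.
    by apply: cvg_expr; apply: cvg_conjc; apply: cvg_toC; exact: cvg_id.
  exact: (cvgM (cvgM h1 (C1_on_cvg g1 (p := p))) (cvg_cst b^-1)).
exists c => // z z0; set t := cmod z.
have t0 : 0 < t by rewrite cmod_gt0.
have tC0 : (t%:C : R[i]) != 0 by rewrite -cmod_eq0 cmodR normr_eq0 gt_eqF.
pose y := z / t%:C.
have y1 : cmod y = 1 by rewrite cmodM cmodV cmodR gtr0_norm// divff// gt_eqF.
have zE : z = t%:C * y by rewrite mulrC divfK.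
have -> : z^* ^+ N * g z / b = (t ^+ (N + k))%:C * (y^* ^+ N * g y / b).
  have -> : ((t ^+ (N + k))%:C : R[i]) = t%:C ^+ N * t%:C ^+ k.
    by rewrite exprD rmorphM /= !rmorphXn.
  rewrite [in LHS]zE gh// rmorphXn; move: y {y1 zE} => y /=.
  rewrite rmorphM /= [(t%:C : R[i])^*]conjCE conjc_real exprMn.
  by move: (y^* ^+ N) (g y) (t%:C ^+ N) (t%:C ^+ k) (b^-1) => *; ring.
rewrite ReZ mulrC; apply: ler_wpM2l; last exact: cmin.
by rewrite exprn_ge0// ltW.
Qed.

End LowerBound.

(** * The polynomial and the sign of its imaginary part *)

Section PolynomialCondition.
Variable R : realType.

(** The factor D is the divided difference of the power N + 1 between 1 + h/w and 1. It depends on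
    h/w alone and tends to N + 1 as h/w tends to 0, so one [d] serves all [w]. *)
Lemma pow_increment (N : nat) (e : R) : 0 < e -> exists2 d : R, 0 < d &
  forall w h : R[i], w != 0 -> cmod h < d * cmod w ->
  exists2 D : R[i], (w + h) ^+ N.+1 - w ^+ N.+1 = w ^+ N * h * D &
    cmod (D - N.+1%:R) < e.
Proof.
move=> e0.
have c1 : (fun p : R * R => divdiff N.+1 (1 + toC p) 1) @ (0 : R * R) --> (N.+1%:R : R[i]).
  have -> : N.+1%:R = divdiff N.+1 (1 + toC 0) 1 :> R[i].
    rewrite (_ : toC 0 = 0)// addr0 /divdiff.
    under eq_bigr do rewrite !expr1n mulr1.
    by rewrite sumr_const card_ord.
  apply: cvg_divdiff; last exact: cvg_cst.
  apply: cvgD; first exact: cvg_cst.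
  by apply: cvg_toC; exact: cvg_id.
move/cvg_cmodP/(_ _ e0)/nbhs_normP : c1 => [d /= d0 H].
exists d => // w h w0 hd; exists (divdiff N.+1 (1 + h / w) 1).
  have -> : w + h = w * (1 + h / w) by field.
  rewrite exprMn -[X in _ - X]mulr1 -mulrBr -[X in _ - X](expr1n _ N.+1) subrXX.
  rewrite -/(divdiff _ _ _); move: (divdiff _ _ _) => D.
  by rewrite exprSr; field.
have := H (ofC (h / w)); rewrite ofCK; apply.
rewrite /ball_ /= sub0r normrN (le_lt_trans (ofC_norm _))//.
by rewrite cmodM cmodV ltr_pdivrMr// cmod_gt0.
Qed.

(* Real-valued on [zeta2 = zeta1^*]. *)
Definition cpoly (b : R[i]) (N : nat) : {poly {poly R[i]}} :=
  b%:P *: 'X^(N.+1) + (b^* *: 'X^(N.+1))%:P.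

Lemma peval2_cpoly b N z1 z2 :
  peval2 (cpoly b N) z1 z2 = b * z2 ^+ N.+1 + b^* * z1 ^+ N.+1.
Proof. by rewrite /peval2 /cpoly !hornerE. Qed.

(** With k = i/b, the term in z1 is the conjugate of k conj z^(N+1), so its imaginary part enters
    with a minus sign; then Im (i x) = Re x. *)
Lemma Im_peval2_cpoly (b : R[i]) N z h :
  complex.Im (peval2 (cpoly (Complex 0 1 / b) N) z (z^* + h)) =
  complex.Re (((z^* + h) ^+ N.+1 - z^* ^+ N.+1) / b).
Proof.
rewrite peval2_cpoly; set k := _ / b.
have -> : k^* * z ^+ N.+1 = (k * z^* ^+ N.+1)^*.
  by rewrite [RHS]rmorphM /= rmorphXn /= conjCK.
rewrite ImD (_ : complex.Im (_^*) = - complex.Im (k * z^* ^+ N.+1)); last first.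
  by rewrite conjCE; case: (k * _).
rewrite -ImN -ImD -mulrBr /k -mulrA mulrC [b^-1 * _]mulrC.
by case: (_ / b) => x y /=; rewrite mulr0 mulr1 addr0 ?add0r.
Qed.

Lemma poly_condition_of_lower_bound (g : R[i] -> R[i]) (b : R[i]) (N m : nat) (M c : R) :
  (0 < m)%N -> b != 0 -> 0 < M -> 0 < c ->
  (forall z, g (- z) = g z) -> C1_on setT g ->
  (forall z, cmod (g z) <= M * cmod z ^+ (2 * m)) ->
  (forall z, z != 0 ->
    c * cmod z ^+ (N + 2 * m) <= complex.Re (z^* ^+ N * g z / b)) ->
  poly_condition g.
Proof.
move=> m0 b0 M0 c0 gN g1 gM gc.
have b0' : 0 < cmod b by rewrite cmod_gt0.
(* Since 2m >= 2, this makes g quadratically small: it yields g(z) = o(z), and later |h| < d |z|. *)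
have pow_le (z : R[i]) : cmod z <= 1 -> cmod z ^+ (2 * m) <= cmod z * cmod z.
  move=> z1; rewrite -expr2 exprM -[leRHS]expr1; apply: ler_wiXn2l => //.
  - by rewrite exprn_ge0 ?cmod_ge0.
  - by rewrite exprn_ile1 ?cmod_ge0.
split; [|split; [|split]].
- by exists 1; split.
- by exists 1; split=> //; case: g1 => d1 d2; split=> [p _|v p _]; [exact: d1|exact: d2].
- move=> e e0; exists (Num.min 1 (e / M)).
  split; first by rewrite lt_min ltr01 divr_gt0.
  move=> z; rewrite lt_min => /andP[z1 ze].
  rewrite (le_trans (gM z))//= (le_trans (ler_wpM2l (ltW M0) (pow_le z (ltW z1))))//.
  by rewrite mulrA ler_wpM2r ?cmod_ge0// mulrC -ler_pdivlMr// ltW.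
exists (cpoly (Complex 0 1 / b) N) => Rf _ Rfg.
(* The error consists of (N + 1) R, at most (N + 1) e |g|, and h (D - (N + 1)), at most 2 |g| e;
   together e K |g|. The choice of [e] keeps e K M / |b| strictly below [c]. *)
pose K : R := N.+1%:R + 2.
have K0 : 0 < K by rewrite ltr_wpDl.
pose e := Num.min 1 (c * cmod b / (2 * M * K)).
have e0 : 0 < e by rewrite lt_min ltr01 divr_gt0// !mulr_gt0.
have e1 : e <= 1 by rewrite ge_min lexx.
have eK : e * (M * K) < c * cmod b.
  have : e <= c * cmod b / (2 * M * K) by rewrite ge_min lexx orbT.
  rewrite ler_pdivlMr ?mulr_gt0// => h.
  have : 0 < c * cmod b by rewrite mulr_gt0.
  lra.
have [d d0 Hd] := pow_increment N e0.
have [d' [d'0 Hd']] := Rfg e e0.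
(* The three radii serve, in order, |R| <= e |g|, the bound |z|^(2m) <= |z|^2, and |h| <= 2 M |z|^2
   < d |z|. *)
exists (Num.min d' (Num.min 1 (d / (2 * M)))); split.
  by rewrite !lt_min d'0 ltr01 divr_gt0// mulr_gt0.
move=> z z0; rewrite !lt_min => /andP[zd' /andP[z1 zd]].
have zp : 0 < cmod z by rewrite cmod_gt0.
have rg := Hd' z zd'.
(* The sign [s] treats both inequalities at once: multiplied by [s], the leading term is the same
   positive quantity in either case. *)
suff key (s : R) : s = 1 \/ s = -1 ->
    0 < s * complex.Im (peval2 (cpoly (Complex 0 1 / b) N) z (z^* + (s%:C * g z + Rf z))).
  have := key 1 (or_introl erefl); have := key (-1) (or_intror erefl).
  by rewrite rmorphN rmorph1 mulN1r !mul1r mulN1r oppr_gt0 !addrA => ? ?; split.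
move=> s1; rewrite Im_peval2_cpoly; set h := s%:C * g z + Rf z.
have ns : `|s| = 1 by case: s1 => ->; rewrite ?normrN normr1.
have ss : s * s = 1 by case: s1 => ->; rewrite ?mulrNN mulr1.
have hg : cmod h <= 2 * cmod (g z).
  rewrite (le_trans (cmodD _ _))// cmodM cmodR ns mul1r.
  have : e * cmod (g z) <= cmod (g z) by rewrite ler_piMl ?cmod_ge0.
  lra.
have zJ0 : z^* != 0 by rewrite conjC_eq0.
have [|D -> De] := Hd z^* h zJ0.
  rewrite cmodJ (le_lt_trans hg)//.
  rewrite (le_lt_trans (ler_wpM2l _ (gM z)))//.
  rewrite (le_lt_trans (ler_wpM2l _ (ler_wpM2l (ltW M0) (pow_le z (ltW z1)))))//.
  by rewrite !mulrA ltr_pM2r// mulrC -ltr_pdivlMr// mulr_gt0.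
(* Replacing D by N + 1 and h by s g isolates the leading term; the rest is the error estimated by
   [K]. *)
have -> : z^* ^+ N * h * D / b = (s * N.+1%:R)%:C * (z^* ^+ N * g z / b)
    + z^* ^+ N / b * (Rf z * N.+1%:R + h * (D - N.+1%:R)).
  rewrite rmorphM /= rmorph_nat /h.
  by move: (z^* ^+ N) (g z) (Rf z) (s%:C) (b^-1) => *; ring.
set E := z^* ^+ N / b * _.
rewrite ReD ReZ mulrDr mulrA mulrA ss mul1r.
have h1 : c * cmod z ^+ (N + 2 * m) <= N.+1%:R * complex.Re (z^* ^+ N * g z / b).
  apply: le_trans (gc z z0) _; rewrite ler_peMl ?ler1n//.
  by apply: le_trans (gc z z0); rewrite mulr_ge0 ?exprn_ge0 ?cmod_ge0// ltW.
have h2 : cmod E < c * cmod z ^+ (N + 2 * m).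
  have zN : 0 < cmod z ^+ (N + 2 * m) by rewrite exprn_gt0.
  rewrite /E !cmodM cmodV cmodX cmodJ.
  apply: (@le_lt_trans _ _ (cmod z ^+ N / cmod b * (e * K * cmod (g z)))).
    rewrite ler_wpM2l ?divr_ge0 ?exprn_ge0 ?cmod_ge0//.
    rewrite (le_trans (cmodD _ _))// !cmodM cmod_nat.
    have t1 : cmod (Rf z) * N.+1%:R <= e * cmod (g z) * N.+1%:R by rewrite ler_wpM2r.
    have t2 : cmod h * cmod (D - N.+1%:R) <= 2 * cmod (g z) * e.
      by rewrite ler_pM ?cmod_ge0// ltW.
    by apply: le_trans (lerD t1 t2) _; rewrite /K; lra.
  apply: (@le_lt_trans _ _ (cmod z ^+ N / cmod b * (e * K * (M * cmod z ^+ (2 * m))))).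
    rewrite ler_wpM2l ?divr_ge0 ?exprn_ge0 ?cmod_ge0//.
    by rewrite ler_wpM2l// mulr_ge0 ?ltW.
  have -> : cmod z ^+ N / cmod b * (e * K * (M * cmod z ^+ (2 * m)))
      = e * (M * K) / cmod b * cmod z ^+ (N + 2 * m).
    by rewrite exprD; ring.
  by rewrite ltr_pM2r// ltr_pdivrMr.
have : `|s * complex.Re E| <= cmod E by rewrite normrM ns mul1r Re_le_cmod.
rewrite ler_norml => /andP[]; lra.
Qed.

End PolynomialCondition.

(** * Reduction to condition (iii) and conclusion *)

Unset Implicit Arguments. Set Strict Implicit. Set Printing Implicit Defensive.

Theorem theorem3p3 (R : realType) (m : nat) (a : int -> R[i]) :
  (0 < m)%N ->
  zsummable (fun k : int => cmod (k%:~R * a k)) ->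
  ((exists l : int, l <= m%:Z /\
       zsumR (fun n => if n == l then 0 else cmod (a n)) < cmod (a l)) \/
   (exists l : int, l <= m%:Z /\ a l != 0 /\
       rseries (fun n => cmod (bcoef a l n.+1)) < 1) \/
   (exists l : int, l <= m%:Z /\ a l != 0 /\
       forall w : R[i], cmod w = 1 ->
         0 < complex.Re (1 + cseries (fun n => bcoef a l n.+1 * w ^+ n.+1)))) ->
  (forall z, gfun m a (- z) = gfun m a z) /\
  (forall (t : R) (z : R[i]), 0 < t ->
     gfun m a (t%:C * z) = (t ^+ (2 * m))%:C * gfun m a z) /\
  C1_on setT (gfun m a) /\
  poly_condition (gfun m a).
Proof.
move=> m0 ha cond.
have gN z := gfunN ha z m0.
have gZ (t : R) z := gfunZ ha z m0 (t := t).
have g1 := C1_gfun ha m0.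
split=> //; split=> //; split=> //.
have [l [lm [al0 pos]]] : exists l : int, l <= m%:Z /\ a l != 0 /\
    forall w : R[i], cmod w = 1 ->
      0 < complex.Re (1 + cseries (fun n => bcoef a l n.+1 * w ^+ n.+1)).
  case: cond => [[l [lm dom]]|[[l [lm [al0 b1]]]|//]]; exists l; split=> //.
  - split; last exact: bcoef_Re_gt0 (bcoef_dominant ha dom).
    (* In case (i), a_l != 0 because |a_l| strictly exceeds a sum of nonnegative terms. *)
    rewrite -cmod_gt0; apply: le_lt_trans dom.
    have cv : zcvg (fun n => if n == l then 0 else cmod (a n)).
      apply: zcvg_le (zcvg_coef ha) => k.
      by case: ifP => _; rewrite ?normr0 ?cmod_ge0 ?ger0_norm ?cmod_ge0.
    have v0 (k : int) : 0 <= (if k == l then 0 else cmod (a k)).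
      by case: ifP => // _; exact: cmod_ge0.
    by case: cv => cp cn; rewrite addr_ge0// rseries_ge0.
  - by split=> //; exact: bcoef_Re_gt0.
have [M [M0 gM]] := gfun_bound ha m0.
(* The exponent N = 2(m - l) is the one for which conj z^N g(z) / a_l has, on the circle, the real
   part controlled by (iii) at w = conj z / z. *)
have [||c c0 gc] := homogeneous_Re_lower_bound (N := 2 * `|m%:Z - l|) (b := a l) (k := 2 * m) _ g1 gZ.
- by rewrite muln_gt0.
- move=> z z1; rewrite (Re_gfun_circle ha m0 lm al0 z1); apply: pos.
  by rewrite dir_eq1// -cmod_gt0 z1.
exact: (poly_condition_of_lower_bound m0 al0 M0 c0 gN g1 gM gc).
Qed.
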